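(* Let $X$ be an effective Banach space. A linear operator $T\colon X_k\to X_k$ is effective if and only if it is effectively determined and continuous.
   Context: $X$ is an effective Banach space: a Banach space with a Pour-El–Richards computability structure (a set of ''computable sequences'' closed under computable linear combinations and effective limits, whose norms are computable real sequences) admitting an effectively generating set (e.g.s.), i.e. a computable sequence with dense linear span; $X_k$ is the set of computable elements. Fixing an e.g.s. $(e_n)$ and a computable enumeration $(a_n)$ of its rational span, the standard numbering $\alpha$ is: $e\in\operatorname{dom}\alpha$ iff $\varphi_e$ is total and $\|a_{\varphi_e(n)}-\lim_m a_{\varphi_e(m)}\|<2^{-n}$ for all $n$, $\alpha e=\lim_m a_{\varphi_e(m)}$. $T$ is effective if there is a partial recursive $\psi$ with $T(\alpha e)=\alpha\psi(e)$ for all $e\in\operatorname{dom}\alpha$. A bounded operator $T$ is effectively determined if there is an e.g.s. $(e_n)$ of $X$ such that $(Te_n)$ is a computable sequence. *)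

(* Defs.v *)
From HB Require Import structures.
From Stdlib Require Cantor.
From mathcomp Require Import all_boot all_order all_algebra.
From mathcomp Require Import complex.
From mathcomp Require Import all_classical all_reals all_analysis.

Set Implicit Arguments.
Unset Strict Implicit.
Unset Printing Implicit Defensive.

Import Order.TTheory GRing.Theory Num.Theory.
Import numFieldNormedType.Exports.

Local Open Scope classical_set_scope.
Local Open Scope ring_scope.

Definition npair (x y : nat) : nat := Cantor.to_nat (x, y).
Definition nfst (n : nat) : nat := (Cantor.of_nat n).1.
Definition nsnd (n : nat) : nat := (Cantor.of_nat n).2.

(* Partial recursive functions. Functions of several arguments are coded as
   functions of one argument through the Cantor pairing. *)

Inductive code : Type :=
| Zero
| Succ
| Fst
| Snd
| Pair of code & code
| Comp of code & code
| Rec of code & code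
| Mu of code.

(* eval c x y : the partial function with code c is defined at x with value y.
   In eval_mu the function h collects the predecessors of the nonzero values
   taken before the least zero. *)
Inductive eval : code -> nat -> nat -> Prop :=
| eval_zero x : eval Zero x 0%N
| eval_succ x : eval Succ x x.+1
| eval_fst x : eval Fst x (nfst x)
| eval_snd x : eval Snd x (nsnd x)
| eval_pair f g x y z :
    eval f x y -> eval g x z -> eval (Pair f g) x (npair y z)
| eval_comp f g x y z :
    eval g x y -> eval f y z -> eval (Comp f g) x z
| eval_rec0 f g x y :
    eval f x y -> eval (Rec f g) (npair x 0) y
| eval_recS f g x n y z :
    eval (Rec f g) (npair x n) y ->
    eval g (npair x (npair n y)) z ->
    eval (Rec f g) (npair x n.+1) z
| eval_mu f x n (h : nat -> nat) :
    (forall m, (m < n)%N -> eval f (npair x m) (h m).+1) ->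
    eval f (npair x n) 0%N ->
    eval (Mu f) x n.

Fixpoint goedel (c : code) : nat :=
  match c with
  | Zero => npair 0 0
  | Succ => npair 1 0
  | Fst => npair 2 0
  | Snd => npair 3 0
  | Pair f g => npair 4 (npair (goedel f) (goedel g))
  | Comp f g => npair 5 (npair (goedel f) (goedel g))
  | Rec f g => npair 6 (npair (goedel f) (goedel g))
  | Mu f => npair 7 (goedel f)
  end.

Lemma npair_inj x y x' y' : npair x y = npair x' y' -> x = x' /\ y = y'.
Proof.
move=> /(congr1 Cantor.of_nat); rewrite /npair !Cantor.cancel_of_to.
by case=> -> ->.
Qed.

Lemma goedel_inj : injective goedel.
Proof.
elim=> [||||f IHf g IHg|f IHf g IHg|f IHf g IHg|f IHf];
  case=> [||||f' g'|f' g'|f' g'|f'] //=; do 1?[by case/npair_inj].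
- by case/npair_inj=> _ /npair_inj[/IHf-> /IHg->].
- by case/npair_inj=> _ /npair_inj[/IHf-> /IHg->].
- by case/npair_inj=> _ /npair_inj[/IHf-> /IHg->].
- by case/npair_inj=> _ /IHf->.
Qed.

(* phi e is the graph of the e-th partial recursive function; it is empty when
   e is not the Goedel number of a code. *)
Definition phi (e x y : nat) : Prop := exists2 c, goedel c = e & eval c x y.

Definition partial_recursive (psi : nat -> nat -> Prop) : Prop :=
  exists e, forall x y, psi x y <-> phi e x y.

Definition recursive (f : nat -> nat) : Prop :=
  partial_recursive (fun x y => f x = y).

Definition uncurry_seq {A : Type} (x : nat -> nat -> A) : nat -> A :=
  fun n => x (nfst n) (nsnd n).

Definition computable_rat_seq (r : nat -> rat) : Prop :=
  exists s p q : nat -> nat,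
    [/\ recursive s, recursive p, recursive q &
        forall n, q n <> 0%N /\
                  r n = (-1) ^+ s n * ((p n)%:R / (q n)%:R)].

Definition computable_real_seq (R : realType) (x : nat -> R) : Prop :=
  exists2 r : nat -> nat -> rat,
    computable_rat_seq (uncurry_seq r) &
    forall n k, `|ratr (r n k) - x n| <= 2 ^- k.

(* Banach spaces may be real or complex. *)
Inductive scalar_kind : Type := RealScalars | ComplexScalars.

Definition scalar_field (R : realType) (F : scalar_kind) : numFieldType :=
  match F with
  | RealScalars => R
  | ComplexScalars => R[i]
  end.

Definition computable_scalar_seq (R : realType) (F : scalar_kind) :
    (nat -> scalar_field R F) -> Prop :=
  match F with
  | RealScalars => fun x => computable_real_seq (x : nat -> R)
  | ComplexScalars => fun z : nat -> R[i] =>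
      computable_real_seq (fun n => complex.Re (z n)) /\
      computable_real_seq (fun n => complex.Im (z n))
  end.

Definition computable_scalar (R : realType) (F : scalar_kind)
    (c : scalar_field R F) : Prop :=
  computable_scalar_seq (fun _ : nat => c).

Definition rational_scalar (R : realType) (F : scalar_kind) :
    set (scalar_field R F) :=
  match F with
  | RealScalars => [set c : R | exists p : rat, c = ratr p]
  | ComplexScalars =>
      [set c : R[i] | exists p q : rat, c = Complex (ratr p) (ratr q)]
  end.

Section EffectiveBanach.
Variables (R : realType) (F : scalar_kind).
Variable X : completeNormedModType (scalar_field R F).
Implicit Types (S : set (nat -> X)) (e a : nat -> X) (T : X -> X).

(* The elements of S are the computable sequences of X. *)
Record computability_structure S : Prop := ComputabilityStructure {
  linear_forms : forall (x y : nat -> X) (b c : nat -> nat -> scalar_field R F)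
      (d : nat -> nat),
    S x -> S y ->
    computable_scalar_seq (uncurry_seq b) ->
    computable_scalar_seq (uncurry_seq c) ->
    recursive d ->
    S (fun n => \sum_(k < (d n).+1) (b n k *: x k + c n k *: y k));
  effective_limits : forall (x : nat -> nat -> X) (l : nat -> X)
      (m : nat -> nat -> nat),
    S (uncurry_seq x) ->
    recursive (uncurry_seq m) ->
    (forall n N k, (m n N <= k)%N -> `|x n k - l n| <= 2 ^- N) ->
    S l;
  computable_norms : forall x : nat -> X,
    S x -> computable_scalar_seq (fun n => `|x n|)
}.

Definition computable_elements S : set X := [set x | S (fun _ => x)].

Definition span_with (P : set (scalar_field R F)) e : set X :=
  [set x | exists n (c : nat -> scalar_field R F),
    (forall i, P (c i)) /\ x = \sum_(i < n) c i *: e i].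

Definition linear_span e : set X := span_with setT e.

Definition rational_span e : set X := span_with (@rational_scalar R F) e.

Definition effectively_generating S e : Prop :=
  S e /\ dense (linear_span e).

Definition rational_span_enumeration S e a : Prop :=
  S a /\ range a = rational_span e.

(* alpha a i x : i belongs to the domain of the standard numbering determined
   by the enumeration a, and its value there is x. *)
Definition alpha a (i : nat) (x : X) : Prop :=
  exists f : nat -> nat,
    [/\ forall n, phi i n (f n),
        a (f n) @[n --> \oo] --> x &
        forall n, `|a (f n) - x| < 2 ^- n].

(* Operators on the computable elements are represented by functions on X of
   which only the restriction to the computable elements matters. The computable
   elements form a vector space over the field of computable scalars. *)
Definition linear_operator S T : Prop :=
  (forall x, computable_elements S x -> computable_elements S (T x)) /\
  (forall c x y, computable_scalar c ->
     computable_elements S x -> computable_elements S y ->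
     T (c *: x + y) = c *: T x + T y).

Definition effective a T : Prop :=
  exists2 psi, partial_recursive psi &
    forall i x, alpha a i x -> exists2 j, psi i j & alpha a j (T x).

Definition bounded_operator S T : Prop :=
  exists M : scalar_field R F,
    forall x, computable_elements S x -> `|T x| <= M * `|x|.

Definition effectively_determined S T : Prop :=
  bounded_operator S T /\
  exists2 e, effectively_generating S e & S (T \o e).

End EffectiveBanach.

(* Main.v *)
Require Import Defs.
From Stdlib Require Cantor.
From mathcomp Require Import all_boot all_order all_algebra.
From mathcomp Require Import all_classical all_reals all_analysis.
From mathcomp Require Import complex lra.
Import Order.TTheory GRing.Theory Num.Theory.
Import numFieldNormedType.Exports.
Import Defs.

(* Forward direction: an effective T maps a uniformly computable family to a
   uniformly computable family (s-m-n theorem and universal function), so T a is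
   a computable sequence. If u n tends effectively to l while T (u n) stays away
   from T l, then the elements l, or u t when i enters an undecidable recursively
   enumerable set at stage t, form a computable family whose images decide that
   set; hence T (u n) comes close to T l. Applied to null sequences in the
   rational span, and then to approximations of arbitrary computable elements,
   this gives a bound for T near 0, hence boundedness.

   Backward direction: density of the rational span of the sequence e' on which
   T is known and boundedness of T make T a computable; a search then
   approximates each T (a n) by terms of a, and composing the search with an
   index of x gives an index of T x. *)

Set Implicit Arguments.
Unset Strict Implicit.
Unset Printing Implicit Defensive.

Local Open Scope nat_scope.

(** * Recursive functions *)

Lemma nfst_npair x y : nfst (npair x y) = x.
Proof. by rewrite /nfst /npair Cantor.cancel_of_to. Qed.

Lemma nsnd_npair x y : nsnd (npair x y) = y.
Proof. by rewrite /nsnd /npair Cantor.cancel_of_to. Qed.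

Definition npairK := (nfst_npair, nsnd_npair).

Lemma npair_proj z : npair (nfst z) (nsnd z) = z.
Proof.
by rewrite /npair /nfst /nsnd -surjective_pairing Cantor.cancel_to_of.
Qed.

Lemma uncurry_npair A (x : nat -> nat -> A) n k :
  uncurry_seq x (npair n k) = x n k.
Proof. by rewrite /uncurry_seq !npairK. Qed.

(** Arguments such as [npair x n] are not constructor patterns, so the [Rec] case is inverted in
    terms of [nfst x] and [nsnd x]. *)
Lemma eval_inv c x z : eval c x z ->
  match c with
  | Zero => z = 0
  | Succ => z = x.+1
  | Fst => z = nfst x
  | Snd => z = nsnd x
  | Pair f g => exists y1 y2, [/\ eval f x y1, eval g x y2 & z = npair y1 y2]
  | Comp f g => exists2 y, eval g x y & eval f y z
  | Rec f g =>
      nsnd x = 0 /\ eval f (nfst x) z \/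
      exists n y, [/\ nsnd x = n.+1, eval (Rec f g) (npair (nfst x) n) y &
                     eval g (npair (nfst x) (npair n y)) z]
  | Mu f =>
      (forall m, m < z -> exists y, eval f (npair x m) y.+1) /\
      eval f (npair x z) 0
  end.
Proof.
case=> {c x z} //.
- by move=> f g x y z Hf Hg; exists y, z.
- by move=> f g x y z Hg Hf; exists y.
- by move=> f g x y Hf; left; rewrite !npairK.
- by move=> f g x n y z Hr Hg; right; exists n, y; rewrite !npairK.
- by move=> f x n h Hlt H0; split=> // m /Hlt; exists (h m).
Qed.

Lemma eval_det c x y : eval c x y -> forall z, eval c x z -> y = z.
Proof.
elim=> {c x y}; do 1?[by move=> x z /eval_inv].
- move=> f g x y z _ IHf _ IHg w /eval_inv[y1 [y2 [/IHf -> /IHg -> ->]]] //.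
- by move=> f g x y z _ IHg _ IHf w /eval_inv[u /IHg <-]; apply: IHf.
- move=> f g x y _ IHf z /eval_inv; rewrite !npairK.
  by case=> [[_]|[n [u []]]//]; apply: IHf.
- move=> f g x n y z _ IHr _ IHg w /eval_inv; rewrite !npairK.
  by case=> [[]//|[m [u [[<-] /IHr <-]]]]; apply: IHg.
- move=> f x n h _ IHlt _ IH0 z /eval_inv[Hlt H0].
  (* Of two distinct results, the smaller would be a place where [f] takes both a zero and a nonzero
     value. *)
  case: (ltngtP n z) => // Hn.
  + by have [y /IH0] := Hlt _ Hn.
  + by have := IHlt _ Hn _ H0.
Qed.

(** A total function has a value somewhere, so its index is the Goedel number of a code; injectivity
    of [goedel] lets this one code serve all arguments. *)
Lemma recursiveP f : recursive f <-> exists c, forall x, eval c x (f x).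
Proof.
split.
- move=> [e He].
  have [c Ec _] := (He 0 (f 0)).1 erefl; exists c => x.
  have [c' Ec' Hc'] := (He x (f x)).1 erefl.
  by rewrite -Ec in Ec'; rewrite -(goedel_inj Ec').
- move=> [c Hc]; exists (goedel c) => x y; split.
  + by move=> <-; exists c.
  + by move=> [c' /goedel_inj -> /(eval_det (Hc x))].
Qed.

Lemma recursive_ext f g : f =1 g -> recursive f -> recursive g.
Proof. by move=> /funext ->. Qed.

Lemma recursive_succ : recursive (fun x => x.+1).
Proof. by apply/recursiveP; exists Succ; constructor. Qed.

Lemma recursive_nfst : recursive nfst.
Proof. by apply/recursiveP; exists Fst; constructor. Qed.

Lemma recursive_nsnd : recursive nsnd.
Proof. by apply/recursiveP; exists Snd; constructor. Qed.

Lemma recursive_npair f g :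
  recursive f -> recursive g -> recursive (fun x => npair (f x) (g x)).
Proof.
move=> /recursiveP[c Hc] /recursiveP[d Hd]; apply/recursiveP.
by exists (Pair c d); constructor.
Qed.

Lemma recursive_comp f g :
  recursive f -> recursive g -> recursive (fun x => f (g x)).
Proof.
move=> /recursiveP[c Hc] /recursiveP[d Hd]; apply/recursiveP.
by exists (Comp c d) => x; apply: eval_comp (Hd x) (Hc _).
Qed.

Lemma recursive_id : recursive (fun x => x).
Proof.
apply: (recursive_ext npair_proj).
exact: recursive_npair recursive_nfst recursive_nsnd.
Qed.

Fixpoint const_code n : code :=
  if n is m.+1 then Comp Succ (const_code m) else Zero.

Lemma eval_const_code n x : eval (const_code n) x n.
Proof.
elim: n => [|n IHn] /=; first exact: eval_zero.
exact: eval_comp IHn (eval_succ _).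
Qed.

Lemma recursive_const n : recursive (fun _ => n).
Proof. by apply/recursiveP; exists (const_code n) => x; apply: eval_const_code. Qed.

Lemma recursive_op2 op f g : recursive (uncurry_seq op) ->
  recursive f -> recursive g -> recursive (fun x => op (f x) (g x)).
Proof.
move=> Hop Hf Hg; have := recursive_comp Hop (recursive_npair Hf Hg).
by apply: recursive_ext => x; rewrite uncurry_npair.
Qed.

Lemma recursive_primrec f (g : nat -> nat -> nat -> nat) h :
  recursive f ->
  recursive (fun z => g (nfst z) (nfst (nsnd z)) (nsnd (nsnd z))) ->
  (forall x, h x 0 = f x) -> (forall x n, h x n.+1 = g x n (h x n)) ->
  recursive (uncurry_seq h).
Proof.
move=> /recursiveP[c Hc] /recursiveP[d Hd] h0 hS; apply/recursiveP.
exists (Rec c d) => z; rewrite -{1}(npair_proj z) /uncurry_seq.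
elim: (nsnd z) => [|n IHn]; first by rewrite h0; apply: eval_rec0.
apply: eval_recS IHn _; rewrite hS.
by have := Hd (npair (nfst z) (npair n (h (nfst z) n))); rewrite !npairK.
Qed.

Lemma recursive_mu (t : nat -> nat -> nat) p : recursive (uncurry_seq t) ->
  (forall x, t x (p x) = 0) -> (forall x m, m < p x -> t x m <> 0) ->
  recursive p.
Proof.
move=> /recursiveP[c Hc] tp tm; apply/recursiveP; exists (Mu c) => x.
apply: (@eval_mu _ _ _ (fun m => (t x m).-1)) => [m /tm tm0|].
  by rewrite prednK ?lt0n; [have := Hc (npair x m); rewrite uncurry_npair
    | apply/eqP].
by have := Hc (npair x (p x)); rewrite uncurry_npair tp.
Qed.

Lemma recursive_pred : recursive predn.
Proof.
have H : recursive (uncurry_seq (fun _ n => n.-1)).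
  apply: (@recursive_primrec (fun _ => 0) (fun _ n _ => n)) => //.
    exact: recursive_const.
  exact: recursive_comp recursive_nfst recursive_nsnd.
have := recursive_comp H (recursive_npair recursive_id recursive_id).
by apply: recursive_ext => x; rewrite uncurry_npair.
Qed.

Definition nsnd2 z := nsnd (nsnd z).

Lemma recursive_nsnd2 : recursive nsnd2.
Proof. exact: recursive_comp recursive_nsnd recursive_nsnd. Qed.

Lemma recursive_add f g :
  recursive f -> recursive g -> recursive (fun x => f x + g x).
Proof.
apply: recursive_op2; apply: (recursive_primrec (g := fun _ _ y => y.+1)).
- exact: recursive_id.
- exact: recursive_comp recursive_succ recursive_nsnd2.
- exact: addn0.
- exact: addnS.
Qed.

Lemma recursive_sub f g :
  recursive f -> recursive g -> recursive (fun x => f x - g x).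
Proof.
apply: recursive_op2; apply: (recursive_primrec (g := fun _ _ y => y.-1)).
- exact: recursive_id.
- exact: recursive_comp recursive_pred recursive_nsnd2.
- exact: subn0.
- exact: subnS.
Qed.

Lemma recursive_mul f g :
  recursive f -> recursive g -> recursive (fun x => f x * g x).
Proof.
apply: recursive_op2; apply: (recursive_primrec (g := fun x _ y => x + y)).
- exact: (recursive_const 0).
- exact: recursive_add recursive_nfst recursive_nsnd2.
- exact: muln0.
- exact: mulnS.
Qed.

Lemma recursive_exp f g :
  recursive f -> recursive g -> recursive (fun x => f x ^ g x).
Proof.
apply: recursive_op2; apply: (recursive_primrec (g := fun x _ y => x * y)).
- exact: (recursive_const 1).
- exact: recursive_mul recursive_nfst recursive_nsnd2.
- exact: expn0.
- exact: expnS.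
Qed.

Lemma recursive_eq0 f : recursive f -> recursive (fun x => f x == 0 : nat).
Proof.
move=> Hf; apply: (@recursive_ext (fun x => 1 - f x)); last first.
  exact: recursive_sub (recursive_const 1) Hf.
by move=> x; case: (f x).
Qed.

Lemma recursive_leq f g :
  recursive f -> recursive g -> recursive (fun x => f x <= g x : nat).
Proof. by move=> Hf Hg; apply/recursive_eq0/recursive_sub. Qed.

Lemma recursive_andb (b c : nat -> bool) : recursive b -> recursive c ->
  recursive (fun x => b x && c x : nat).
Proof.
move=> Hb Hc; apply: recursive_ext (recursive_mul Hb Hc) => x.
by rewrite mulnb.
Qed.

Lemma recursive_negb (b : nat -> bool) : recursive b ->
  recursive (fun x => ~~ b x : nat).
Proof.
move=> Hb; apply: recursive_ext (recursive_eq0 Hb) => x.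
by case: (b x).
Qed.

Lemma recursive_orb (b c : nat -> bool) : recursive b -> recursive c ->
  recursive (fun x => b x || c x : nat).
Proof.
move=> Hb Hc.
have := recursive_negb (recursive_andb (recursive_negb Hb) (recursive_negb Hc)).
by apply: recursive_ext => x; rewrite negb_and !negbK.
Qed.

Lemma recursive_eq f g :
  recursive f -> recursive g -> recursive (fun x => f x == g x : nat).
Proof.
move=> Hf Hg.
have := recursive_andb (recursive_leq Hf Hg) (recursive_leq Hg Hf).
by apply: recursive_ext => x; rewrite -eqn_leq.
Qed.

Lemma recursive_odd f : recursive f -> recursive (fun x => odd (f x) : nat).
Proof.
move=> Hf.
have H : recursive (uncurry_seq (fun _ n => odd n : nat)).
  apply: (@recursive_primrec (fun _ => 0) (fun _ _ y => 1 - y)) => //.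
  - exact: recursive_const.
  - exact: recursive_sub (recursive_const 1) recursive_nsnd2.
  - by move=> _ n /=; case: (odd n).
exact: (recursive_op2 H recursive_id Hf).
Qed.

Lemma recursive_if (b : nat -> bool) f g :
  recursive b -> recursive f -> recursive g ->
  recursive (fun x => if b x then f x else g x).
Proof.
move=> Hb Hf Hg.
have := recursive_add (recursive_mul Hb Hf) (recursive_mul (recursive_negb Hb) Hg).
by apply: recursive_ext => x; case: (b x); rewrite /= ?mul1n ?mul0n ?addn0.
Qed.

(** Works by recursion on the syntax of the body, with recursiveness hypotheses from the context;
    subgoals of any other shape stay open. *)
Ltac solve_recursive :=
  lazymatch goal with
  | |- recursive nfst => exact: recursive_nfst
  | |- recursive nsnd => exact: recursive_nsnd
  | |- recursive (fun x => x) => exact: recursive_id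
  | |- recursive (fun _ => ?n) => exact: (recursive_const n)
  | |- recursive (fun x => npair (@?f x) (@?g x)) =>
      apply: (@recursive_npair f g); solve_recursive
  | |- recursive (fun x => (@?f x).+1) =>
      apply: (@recursive_comp _ f recursive_succ); solve_recursive
  | |- recursive (fun x => (@?f x).-1) =>
      apply: (@recursive_comp _ f recursive_pred); solve_recursive
  | |- recursive (fun x => nfst (@?f x)) =>
      apply: (@recursive_comp _ f recursive_nfst); solve_recursive
  | |- recursive (fun x => nsnd (@?f x)) =>
      apply: (@recursive_comp _ f recursive_nsnd); solve_recursive
  | |- recursive (fun x => (@?f x) + (@?g x)) =>
      apply: (@recursive_add f g); solve_recursive
  | |- recursive (fun x => (@?f x) - (@?g x)) =>
      apply: (@recursive_sub f g); solve_recursive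
  | |- recursive (fun x => (@?f x) * (@?g x)) =>
      apply: (@recursive_mul f g); solve_recursive
  | |- recursive (fun x => (@?f x) ^ (@?g x)) =>
      apply: (@recursive_exp f g); solve_recursive
  | |- recursive (fun x => nat_of_bool (@eq_op _ (@?f x) (@?g x))) =>
      apply: (@recursive_eq f g); solve_recursive
  | |- recursive (fun x => nat_of_bool (leq (@?f x) (@?g x))) =>
      apply: (@recursive_leq f g); solve_recursive
  | |- recursive (fun x => nat_of_bool (andb (@?f x) (@?g x))) =>
      apply: (@recursive_andb f g); solve_recursive
  | |- recursive (fun x => nat_of_bool (orb (@?f x) (@?g x))) =>
      apply: (@recursive_orb f g); solve_recursive
  | |- recursive (fun x => nat_of_bool (negb (@?f x))) =>
      apply: (@recursive_negb f); solve_recursive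
  | |- recursive (fun x => nat_of_bool (odd (@?f x))) =>
      apply: (@recursive_odd f); solve_recursive
  | |- recursive (fun x => if _ then _ else _) =>
      apply: recursive_if; solve_recursive
  | H : recursive ?f |- recursive (fun x => ?f (@?g x)) =>
      apply: (@recursive_comp f g H); solve_recursive
  | H : recursive (uncurry_seq ?op) |- recursive (fun x => ?op (@?f x) (@?g x)) =>
      apply: (@recursive_op2 op f g H); solve_recursive
  | H : recursive ?f |- recursive ?f => exact: H
  | _ => idtac
  end.

(** Minimality of the witness is exported because the continuity argument has to recognize the value
    found as a first stage. *)
Lemma recursive_search (t : nat -> nat -> bool) :
  recursive (uncurry_seq (fun x m => t x m : nat)) ->
  (forall x, exists m, t x m) ->
  exists2 p, recursive p & forall x, t x (p x) /\ forall m, t x m -> p x <= m.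
Proof.
move=> Ht ex; pose p x := ex_minn (ex x).
have Hp x : t x (p x) /\ forall m, t x m -> p x <= m.
  by rewrite /p; case: ex_minnP.
exists p => //; apply: (@recursive_mu (fun x m => ~~ t x m : nat)).
- exact: (recursive_negb Ht).
- by move=> x; rewrite (Hp x).1.
- move=> x m; rewrite ltnNge; case E: (t x m) => //=.
  by rewrite (Hp x).2.
Qed.

(** * A universal machine *)

Definition ev_state c x K := npair 1 (npair (npair c x) K).
Definition ret_state y K := npair 0 (npair y K).
(** The successor keeps a nonempty stack apart from the empty one, which is [0]. *)
Definition push t d K := (npair t (npair d K)).+1.

(* A state either evaluates the code c at x or returns a value, in front of a
   stack K of pending frames; frame tags: 0 and 1 for the two halves of Pair,
   2 for Comp, 3 for Rec, 4 for Mu. *)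
Definition step s :=
  let v := nfst (nsnd s) in let K := nsnd (nsnd s) in
  if nfst s == 0 then
    let t := nfst K.-1 in let d := nfst (nsnd K.-1) in
    let L := nsnd (nsnd K.-1) in
    if K == 0 then s
    else if t == 0 then ev_state (nfst d) (nsnd d) (push 1 v L)
    else if t == 1 then ret_state (npair d v) L
    else if t == 2 then ev_state d v L
    else if t == 3 then
      ev_state (nfst d) (npair (nfst (nsnd d)) (npair (nsnd (nsnd d)) v)) L
    else if v == 0 then ret_state (nsnd (nsnd d)) L
    else
      let y := npair (nfst (nsnd d)) (nsnd (nsnd d)).+1 in
      ev_state (nfst d) y (push 4 (npair (nfst d) y) L)
  else
    let c := nfst v in let x := nsnd v in
    let t := nfst c in let d := nsnd c in
    if t == 0 then ret_state 0 K
    else if t == 1 then ret_state x.+1 K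
    else if t == 2 then ret_state (nfst x) K
    else if t == 3 then ret_state (nsnd x) K
    else if t == 4 then ev_state (nfst d) x (push 0 (npair (nsnd d) x) K)
    else if t == 5 then ev_state (nsnd d) x (push 2 (nfst d) K)
    else if t == 6 then
      let y := npair (nfst x) (nsnd x).-1 in
      if nsnd x == 0 then ev_state (nfst d) (nfst x) K
      else ev_state c y (push 3 (npair (nsnd d) y) K)
    else ev_state d (npair x 0) (push 4 (npair d (npair x 0)) K).

Lemma recursive_step : recursive step.
Proof. rewrite /step /ev_state /ret_state /push; cbv zeta; solve_recursive. Qed.

Definition reach s s' := exists t, iter t step s = s'.

Lemma reach_trans s1 s2 s3 : reach s1 s2 -> reach s2 s3 -> reach s1 s3.
Proof. by move=> [t1 <-] [t2 <-]; exists (t2 + t1); rewrite iterD. Qed.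

Lemma reach_step s s' s'' : step s = s' -> reach s' s'' -> reach s s''.
Proof. by move=> <-; apply: reach_trans; exists 1. Qed.

Lemma reach_refl s : reach s s.
Proof. by exists 0. Qed.

Ltac machine_step :=
  apply: reach_step;
    [rewrite /step /ev_state /ret_state /push /= !npairK /= ?npairK /=;
     reflexivity|].

(** The stack [K] is arbitrary so that the induction hypotheses apply beneath pending frames. *)
Lemma eval_reach c x y : eval c x y ->
  forall K, reach (ev_state (goedel c) x K) (ret_state y K).
Proof.
elim=> {c x y}.
- by move=> x K; machine_step; apply: reach_refl.
- by move=> x K; machine_step; apply: reach_refl.
- by move=> x K; machine_step; apply: reach_refl.
- by move=> x K; machine_step; apply: reach_refl.
- move=> f g x y z _ IHf _ IHg K /=.
  machine_step; eapply reach_trans; [apply IHf|].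
  machine_step; eapply reach_trans; [apply IHg|].
  by machine_step; apply: reach_refl.
- move=> f g x y z _ IHg _ IHf K /=.
  machine_step; eapply reach_trans; [apply IHg|].
  by machine_step; apply IHf.
- by move=> f g x y _ IHf K; machine_step; apply IHf.
- move=> f g x n y z _ IHr _ IHg K.
  machine_step; eapply reach_trans; [apply IHr|].
  by machine_step; apply IHg.
- move=> f x n h _ IHlt _ IH0 K.
  (* [S m] is the state in which the minimization is about to test [m]. *)
  pose S m := ev_state (goedel f) (npair x m)
    (push 4 (npair (goedel f) (npair x m)) K).
  have HS m : m <= n -> reach (ev_state (goedel (Mu f)) x K) (S m).
    elim: m => [_|m IHm Hm].
      by machine_step; apply: reach_refl.
    apply: reach_trans (IHm (ltnW Hm)) _.
    eapply reach_trans; [apply (IHlt _ Hm _)|].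
    by machine_step; apply: reach_refl.
  apply: reach_trans (HS _ (leqnn n)) _.
  eapply reach_trans; [apply IH0|].
  by machine_step; apply: reach_refl.
Qed.

Definition run e x t := iter t step (ev_state e x 0).

Lemma recursive_run f g h : recursive f -> recursive g -> recursive h ->
  recursive (fun z => run (f z) (g z) (h z)).
Proof.
move=> Hf Hg Hh.
have H : recursive (uncurry_seq (fun s t => iter t step s)).
  apply: (@recursive_primrec id (fun _ _ y => step y)) => //.
    exact: recursive_id.
  exact: recursive_comp recursive_step recursive_nsnd2.
apply: (recursive_op2 H) => //.
by rewrite /ev_state; solve_recursive.
Qed.

Definition halted s := (nfst s == 0) && (nsnd (nsnd s) == 0).

Lemma iter_step_halted s t : halted s -> iter t step s = s.
Proof.
move=> /andP[s0 s1]; elim: t => [|t IHt] //=.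
by rewrite IHt /step s0 s1.
Qed.

Lemma halted_ret_state y : halted (ret_state y 0).
Proof. by rewrite /halted /ret_state !npairK. Qed.

(** Halted states are fixed by [step], so the state at time [t] and the final state provided by
    [eval_reach] both equal the state at the sum of the two times. *)
Lemma run_halted c x y t : eval c x y -> halted (run (goedel c) x t) ->
  run (goedel c) x t = ret_state y 0.
Proof.
move=> /eval_reach/(_ 0)[u Hu] Ht.
have := iter_step_halted u Ht; rewrite -iterD addnC iterD Hu.
by rewrite iter_step_halted // halted_ret_state.
Qed.

(** The universal function, for indices of total functions: search for a halting time of the machine
    and read off the returned value. *)
Lemma recursive_universal (j : nat -> nat) (g : nat -> nat -> nat) :
  recursive j -> (forall n k, phi (j n) k (g n k)) ->
  recursive (uncurry_seq g).
Proof.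
move=> Hj Hg.
pose t z u := halted (run (j (nfst z)) (nsnd z) u).
have Ht : recursive (uncurry_seq (fun x m => t x m : nat)).
  rewrite /uncurry_seq /t /halted; solve_recursive.
  - by apply: recursive_run; solve_recursive.
  - by apply: recursive_run; solve_recursive.
have ex z : exists u, t z u.
  rewrite /t; have [c <- /eval_reach/(_ 0)[u Hu]] := Hg (nfst z) (nsnd z).
  by exists u; rewrite /run Hu halted_ret_state.
have [p Hp pP] := recursive_search Ht ex.
apply: (@recursive_ext
  (fun z => nfst (nsnd (run (j (nfst z)) (nsnd z) (p z))))).
  move=> z; have [+ _] := pP z; rewrite /t /uncurry_seq.
  have [c <- Hc] := Hg (nfst z) (nsnd z).
  by move=> /(run_halted Hc) ->; rewrite /ret_state !npairK.
solve_recursive.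
by apply: recursive_run; solve_recursive.
Qed.

(* Only completeness of the machine is needed: instead of halting, the set
   consists of the i at which the machine returns 0 on input i. *)
Lemma undecidable_enumerable : exists h : nat -> nat -> bool,
  recursive (uncurry_seq (fun i t => h i t : nat)) /\
  forall d : nat -> bool, recursive d -> ~ forall i, d i <-> exists t, h i t.
Proof.
exists (fun i t => run i i t == ret_state 0 0); split.
  rewrite /uncurry_seq; solve_recursive.
  by apply: recursive_run; solve_recursive.
move=> d Hd dP.
(* Diagonalization: the code [c] of [d] is run on its own number. Value 1 would mean that the
   machine also returns 0; value 0 would put this number into the set. *)
have /recursiveP[c Hc] : recursive (d : nat -> nat) by [].
have [u] := eval_reach (Hc (goedel c)) 0; rewrite -/(run _ _ _).
case E: (d (goedel c)) => Hu.
  have [t /eqP Ht] := (dP _).1 E.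
  have := run_halted (Hc (goedel c)) (t := t).
  by rewrite Ht E halted_ret_state => /(_ isT) /npair_inj[_ /npair_inj[]].
have : d (goedel c) by apply/dP; exists u; rewrite Hu.
by rewrite E.
Qed.

(** * The s-m-n theorem and composition with an index *)

Lemma recursive_goedel_const_code : recursive (fun n => goedel (const_code n)).
Proof.
have H : recursive (uncurry_seq (fun _ n => goedel (const_code n))).
  apply: (@recursive_primrec (fun _ => goedel Zero)
    (fun _ _ y => npair 5 (npair (goedel Succ) y))) => //; solve_recursive.
exact: (recursive_op2 H recursive_id recursive_id).
Qed.

(** The index for [i] is that of [c] composed with the pairing of the constant [i] and the identity,
    which is written [Pair Fst Snd]. *)
Lemma recursive_smn w : recursive (uncurry_seq w) ->
  exists2 s, recursive s & forall i n, phi (s i) n (w i n).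
Proof.
move=> /recursiveP[c Hc].
exists (fun i => goedel (Comp c (Pair (const_code i) (Pair Fst Snd)))).
  have H := recursive_goedel_const_code.
  by rewrite /=; solve_recursive.
move=> i n; eexists; first reflexivity.
apply: (@eval_comp _ _ _ (npair i n)).
  apply: eval_pair (eval_const_code _ _) _.
  by rewrite -{2}(npair_proj n); do !constructor.
by have := Hc (npair i n); rewrite uncurry_npair.
Qed.

Lemma partial_recursive_total psi (j : nat -> nat) s :
  partial_recursive psi -> recursive s -> (forall i, psi (s i) (j i)) ->
  recursive j.
Proof.
move=> [e He] /recursiveP[cs Hs] Hj.
have [c Ec _] := (He _ _).1 (Hj 0).
apply/recursiveP; exists (Comp c cs) => i; apply: eval_comp (Hs i) _.
have [c' Ec' Hc'] := (He _ _).1 (Hj i).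
by rewrite -Ec in Ec'; rewrite -(goedel_inj Ec').
Qed.

(** * Scalars *)

Local Open Scope classical_set_scope.
Local Open Scope ring_scope.

Lemma exp2V_gt0 (K : numFieldType) k : 0 < 2 ^- k :> K.
Proof. by rewrite invr_gt0 exprn_gt0. Qed.

Lemma exp2V_half (K : numFieldType) k : 2 ^- k.+1 + 2 ^- k.+1 = 2 ^- k :> K.
Proof.
rewrite exprS invfM -mulrDl.
by have := splitr (1 : K); rewrite !div1r => <-; rewrite mul1r.
Qed.

Lemma exp2V_le (K : numFieldType) m n : (m <= n)%N -> 2 ^- n <= 2 ^- m :> K.
Proof. by move=> mn; rewrite lef_pV2 ?posrE ?exprn_gt0 // ler_eXn2l // ltr1n. Qed.

(** Strict comparison of computable reals is undecidable; here the two alternatives overlap between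
    [2 ^- k.+1] and [2 ^- k], so a rational approximation can choose one of them. *)
Lemma real_compare (R : realType) (x : nat -> R) : computable_real_seq x ->
  exists2 b : nat -> nat -> bool,
    recursive (uncurry_seq (fun n k => b n k : nat)) &
    forall n k, if b n k then 2 ^- k.+1 < x n else x n < 2 ^- k.
Proof.
move=> [r [s [p [q [Hs Hp Hq Hr]]]] rx].
pose z n k := npair n k.+3.
(* The rational approximation with error 2^-(k+3) is compared with the
   threshold 3/4 2^-k. *)
exists (fun n k => ~~ odd (s (z n k)) && (3 * q (z n k) < p (z n k) * 2 ^ k.+2)%N).
  by rewrite /uncurry_seq /z; solve_recursive.
move=> n k; have {rx} := rx n k.+3; rewrite -(uncurry_npair r) -/(z n k).
have [q0 ->] := Hr (z n k).
have {q0} : (0 < q (z n k))%N by rewrite lt0n; apply/eqP.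
rewrite rmorphM rmorphXn rmorphN1 fmorph_div /= !ratr_nat.
move: (s _) (p _) (q _) => {Hs Hp Hq Hr}s {}p {}q; rewrite -(ltr_nat R) => q0.
set E : R := 2 ^- k.+3; have E0 : 0 < E by apply: exp2V_gt0.
have H3 := exp2V_half R k.+2; have H2 := exp2V_half R k.+1.
have H1 := exp2V_half R k; rewrite -/E in H3.
(* This turns the integer test [3 * q < p * 2 ^ k.+2] into [6 * E < v], where [6 * E] is three
   quarters of [2 ^- k]. *)
have D : (2 ^ k.+2)%:R * (E *+ 2) = 1 :> R.
  by rewrite mulr2n H3 natrX mulfV // expf_neq0.
rewrite ler_distl -signr_odd -(ltr_nat R) (natrM _ 3) (natrM _ p).
have v0 : 0 <= p%:R / q%:R :> R by apply: divr_ge0.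
have pE : p%:R = p%:R / q%:R * q%:R :> R by rewrite divfK ?gt_eqF.
move: (p%:R / q%:R) v0 pE => v v0 ->.
case: (odd s) => /=; rewrite ?expr1 ?expr0 ?mul1r.
  by move=> /andP[? ?]; lra.
have -> : (3%:R * q%:R < v * q%:R * (2 ^ k.+2)%:R) = (6 * E < v).
  rewrite -mulrAC ltr_pM2r //.
  rewrite -(ltr_pM2r (_ : 0 < E *+ 2)) ?pmulrn_lgt0 // -mulrA D mulr1.
  by congr (_ < _); lra.
by case: ltP => ? /andP[? ?]; lra.
Qed.

(** A nonnegative complex number has zero imaginary part, so the complex case reduces to real
    parts. *)
Lemma nonneg_scalar_compare (R : realType) F (x : nat -> scalar_field R F) :
  (forall n, 0 <= x n) -> computable_scalar_seq x ->
  exists2 b : nat -> nat -> bool,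
    recursive (uncurry_seq (fun n k => b n k : nat)) &
    forall n k, if b n k then 2 ^- k.+1 < x n else x n < 2 ^- k.
Proof.
case: F x => x x0; first exact: real_compare.
move=> [/real_compare[b Hb bP] _]; exists b => // n k.
have := bP n k.
have pow m : 2 ^- m = (2 ^- m : R)%:C%C by rewrite fmorphV rmorphXn rmorph_nat.
have xE : x n = (complex.Re (x n))%:C%C.
  by have := ger0_Im (x0 n); case: (x n) => a c /= ->.
by rewrite !pow xE !ltcR.
Qed.

Lemma exp2V_archimedean (R : realType) F (eps : scalar_field R F) :
  0 < eps -> exists k, 2 ^- k < eps.
Proof.
have arch (e : R) : 0 < e -> exists k, 2 ^- k < e.
  move=> e0; exists (Num.truncn e^-1).+1.
  rewrite invf_plt ?posrE ?exprn_gt0 //.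
  apply: lt_le_trans (truncnS_gt _) _.
  by rewrite -natrX ler_nat ltnW // ltn_expl.
case: F eps => eps; first exact: arch.
move=> e0; have eE : eps = (complex.Re eps)%:C%C.
  by have := ger0_Im (ltW e0); case: (eps) => a c /= ->.
rewrite eE ltcR in e0; have [k Hk] := arch _ e0; exists k.
by rewrite eE -[2]/(2%:R) -(rmorph_nat (real_complex R)) -rmorphXn -fmorphV ltcR.
Qed.

Lemma normc_le_ReD (R : realType) (z : R[i]) :
  `|z| <= (`|complex.Re z| + `|complex.Im z|)%:C%C.
Proof.
rewrite normc_def lecR; move: (complex.Re z) (complex.Im z) => u v.
rewrite -[leRHS]ger0_norm ?addr_ge0 // -sqrtr_sqr ler_wsqrtr // sqrrD.
by rewrite !real_normK ?num_real // lerD2r lerDl mulrn_wge0 // mulr_ge0.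
Qed.

(** The components of [m] are the exponent of the sign, the numerator and the denominator minus one,
    so every natural number is a valid code. *)
Definition nat_rat (m : nat) : rat :=
  (-1) ^+ nfst m * ((nfst (nsnd m))%:R / (nsnd (nsnd m)).+1%:R).

Lemma nat_rat_surj r : exists m, nat_rat m = r.
Proof.
exists (npair (numq r < 0)%R (npair `|numq r| `|denq r|.-1)).
rewrite /nat_rat !npairK prednK ?absz_gt0 ?denq_neq0 //.
rewrite mulrA -[RHS]divq_num_den; congr (_ / _).
- rewrite [in RHS](intEsign (numq r)) rmorphM /= rmorphXn /= rmorphN1.
  by rewrite pmulrn.
- by rewrite pmulrn absz_denq.
Qed.

Lemma computable_nat_rat f : recursive f ->
  computable_rat_seq (fun n => nat_rat (f n)).
Proof.
move=> Hf; exists (fun n => nfst (f n)), (fun n => nfst (nsnd (f n))).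
exists (fun n => (nsnd (nsnd (f n))).+1).
by split=> //; solve_recursive.
Qed.

Lemma computable_ratr_nat_rat (R : realType) f : recursive f ->
  computable_real_seq (fun n => ratr (nat_rat (f n)) : R).
Proof.
move=> Hf; exists (fun n _ => nat_rat (f n)).
  by apply: (@computable_nat_rat (fun z => f (nfst z))); solve_recursive.
by move=> n k; rewrite subrr normr0 ltW // exp2V_gt0.
Qed.

Definition nat_scalar (R : realType) F : nat -> scalar_field R F :=
  match F with
  | RealScalars => fun m => ratr (nat_rat m)
  | ComplexScalars => fun m =>
      Complex (ratr (nat_rat (nfst m))) (ratr (nat_rat (nsnd m)))
  end.

Section Scalars.
Variables (R : realType) (F : scalar_kind).
Notation K := (scalar_field R F).

Lemma rational_nat_scalar m : rational_scalar (nat_scalar R F m).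
Proof. by rewrite /nat_scalar; case: F => /=; do 2?eexists. Qed.

Lemma computable_nat_scalar f : recursive f ->
  computable_scalar_seq (fun n => nat_scalar R F (f n)).
Proof.
move=> Hf; rewrite /nat_scalar; case: F => /=; last split.
- exact: computable_ratr_nat_rat.
- by apply: (@computable_ratr_nat_rat R (fun n => nfst (f n))); solve_recursive.
- by apply: (@computable_ratr_nat_rat R (fun n => nsnd (f n))); solve_recursive.
Qed.

Lemma nat_scalar_int (n : int) : exists m, nat_scalar R F m = n%:~R.
Proof.
have [m Hm] := nat_rat_surj n%:~R; have [m0 Hm0] := nat_rat_surj 0.
rewrite /nat_scalar; case: F.
  by exists m; rewrite Hm ratr_int.
exists (npair m m0); rewrite !npairK Hm Hm0 ratr_int rmorph0.
by rewrite -(rmorph_int (real_complex R)).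
Qed.

Lemma nat_scalar_dense (c : K) k : exists m, `|c - nat_scalar R F m| < 2 ^- k.
Proof.
have dense_real (x : R) j : exists m, `|x - ratr (nat_rat m)| < 2 ^- j.
  have [|r] := @rat_in_itvoo R (x - 2 ^- j) (x + 2 ^- j).
    by have := exp2V_gt0 R j; lra.
  rewrite in_itv /= => /andP[r1 r2].
  have [m mE] := nat_rat_surj r; exists m; rewrite mE.
  by rewrite distrC ltr_distl r1.
move: c; rewrite /nat_scalar; case: F => c /=; first exact: dense_real.
have [m1 H1] := dense_real (complex.Re c) k.+1.
have [m2 H2] := dense_real (complex.Im c) k.+1.
exists (npair m1 m2); rewrite !npairK.
case: c H1 H2 => u v /=; move: (ratr _) (ratr _) => v' u' H1 H2.
have -> : 2 ^- k = (2 ^- k : R)%:C%C :> R[i].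
  by rewrite fmorphV rmorphXn rmorph_nat.
apply: le_lt_trans (normc_le_ReD (Complex (u - u') (v - v'))) _.
by rewrite ltcR -exp2V_half ltrD.
Qed.
End Scalars.

(** * Computable sequences of a Banach space *)

Section ComputabilityStructure.
Variables (R : realType) (F : scalar_kind).
Notation K := (scalar_field R F).
Variable X : completeNormedModType (scalar_field R F).
Variables (S : set (nat -> X)) (hS : computability_structure S).
Implicit Types (x y l : X) (u v : nat -> X).

(** Supplies the Kronecker-delta coefficients with which [linear_forms] picks out single terms. *)
Lemma computable_scalar_if (t : nat -> bool) (m n : int) : recursive t ->
  computable_scalar_seq (fun z => if t z then m%:~R else n%:~R : K).
Proof.
move=> Ht; have [i Hi] := nat_scalar_int R F m.
have [j Hj] := nat_scalar_int R F n.
have -> : (fun z => if t z then m%:~R else n%:~R : K) =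
    (fun z => nat_scalar R F (if t z then i else j)).
  by apply: funext => z; case: (t z).
by apply: computable_nat_scalar; solve_recursive.
Qed.

Lemma computable_scalar_int (n : int) : computable_scalar (n%:~R : K).
Proof.
have := @computable_scalar_if (fun _ => true) n n.
by apply; solve_recursive.
Qed.

Lemma computable_sub_seq u v : S u -> S v -> S (fun n => u n - v n).
Proof.
move=> Su Sv.
pose b m (n k : nat) : K := if k == n then m%:~R else 0%:~R.
have Hb m : computable_scalar_seq (uncurry_seq (b m)).
  by apply: (@computable_scalar_if (fun z => nsnd z == nfst z)); solve_recursive.
have -> : (fun n => u n - v n) =
    (fun n => \sum_(k < n.+1) (b 1 n k *: u k + b (-1) n k *: v k)).
  apply: funext => n; rewrite big_ord_recr big1 /= => [|k _].
    by rewrite /b eqxx add0r scale1r scaleN1r.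
  by rewrite /b ltn_eqF // !scale0r addr0.
exact: (linear_forms hS (b := b 1) (c := b (-1)) Su Sv (Hb 1) (Hb (-1)) recursive_id).
Qed.

(** A sum up to [r n] whose coefficients vanish before the last index is the single term
    [u (r n)]. *)
Lemma computable_reindex u r : S u -> recursive r -> S (fun n => u (r n)).
Proof.
move=> Su Hr.
pose b (n k : nat) : K := if k == r n then 1%:~R else 0%:~R.
have Hb : computable_scalar_seq (uncurry_seq b).
  by apply: (@computable_scalar_if (fun z => nsnd z == r (nfst z)));
    solve_recursive.
have -> : (fun n => u (r n)) =
    (fun n => \sum_(k < (r n).+1) (b n k *: u k + 0 *: u k)).
  apply: funext => n; rewrite big_ord_recr big1 /= => [|k _].
    by rewrite /b eqxx add0r scale1r scale0r addr0.
  by rewrite /b ltn_eqF // !scale0r addr0.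
apply: (linear_forms hS (b := b) (c := fun _ _ => 0)) => //.
exact: (computable_scalar_int 0).
Qed.

Lemma computable_term u n : S u -> computable_elements S (u n).
Proof. by move=> Su; apply: (computable_reindex Su (recursive_const n)). Qed.

Lemma computable_lin c x y : computable_scalar c ->
  computable_elements S x -> computable_elements S y ->
  computable_elements S (c *: x + y).
Proof.
move=> Hc Hx Hy; have Hd := recursive_const 0.
have := linear_forms hS (b := fun _ _ => c) (c := fun _ _ => 1%:~R) Hx Hy Hc
  (computable_scalar_int 1) Hd.
rewrite /computable_elements /=; congr S; apply: funext => n.
by rewrite big_ord1 scale1r.
Qed.

Lemma computable_sub x y : computable_elements S x ->
  computable_elements S y -> computable_elements S (x - y).
Proof. exact: computable_sub_seq. Qed.

Lemma computable_limit u l : S u -> (forall n, `|u n - l| <= 2 ^- n) ->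
  computable_elements S l.
Proof.
move=> Su ul.
apply: (effective_limits hS (x := fun _ k => u k) (m := fun _ N => N)).
- by apply: (computable_reindex Su recursive_nsnd).
- exact: recursive_nsnd.
- by move=> n N k Nk; apply: le_trans (ul k) (exp2V_le _ Nk).
Qed.

Lemma computable_norm_compare u : S u ->
  exists2 b : nat -> nat -> bool,
    recursive (uncurry_seq (fun n k => b n k : nat)) &
    forall n k, if b n k then 2 ^- k.+1 < `|u n| else `|u n| < 2 ^- k.
Proof. by move=> /(computable_norms hS); apply: nonneg_scalar_compare. Qed.

(** The search stops when the overlapping norm test answers that the norm is small. It must answer
    so wherever the norm is below [2 ^- k.+1], hence it terminates. *)
Lemma computable_search (u : nat -> nat -> X) : S (uncurry_seq u) ->
  (forall n k, exists m, `|u n m| < 2 ^- k) ->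
  exists2 p, recursive (uncurry_seq p) & forall n k, `|u n (p n k)| < 2 ^- k.
Proof.
move=> /computable_norm_compare[b Hb bP] ex.
pose t z m := ~~ b (npair (nfst z) m) (nsnd z).
have Ht : recursive (uncurry_seq (fun z m => t z m : nat)).
  rewrite /uncurry_seq /t; solve_recursive.
  by apply: (recursive_op2 Hb); solve_recursive.
have [z|p Hp pP] := recursive_search Ht.
  have [m Hm] := ex (nfst z) (nsnd z).+1; exists m; rewrite /t.
  apply/negP => bT; have := bP (npair (nfst z) m) (nsnd z).
  by rewrite bT uncurry_npair => /(lt_trans Hm); rewrite ltxx.
exists (fun n k => p (npair n k)).
  by rewrite /uncurry_seq; solve_recursive.
move=> n k; have [+ _] := pP (npair n k); rewrite /t !npairK.
have := bP (npair n (p (npair n k))) k.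
by case: (b _ _); rewrite // uncurry_npair.
Qed.

Lemma cvg_exp2V u l : (forall n, `|u n - l| < 2 ^- n) -> u n @[n --> \oo] --> l.
Proof.
move=> ul; apply/cvgrPdist_lt => eps /exp2V_archimedean[k Hk].
exists k => // n /= kn; rewrite distrC.
by apply: lt_trans (ul n) (le_lt_trans (exp2V_le _ kn) Hk).
Qed.

(** Half of the error is spent on reaching the linear span, the other half on replacing its
    coefficients by rational ones, one at a time. *)
Lemma rational_combination_dense e : effectively_generating S e ->
  forall x k, exists n (c : nat -> nat),
    `|\sum_(i < n) nat_scalar R F (c i) *: e i - x| < 2 ^- k.
Proof.
move=> [_ de] x k.
have approx n (c : nat -> K) : forall j, exists c' : nat -> nat,
    `|\sum_(i < n) nat_scalar R F (c' i) *: e i - \sum_(i < n) c i *: e i|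
      < 2 ^- j.
  elim: n => [|n IHn] j.
    by exists id; rewrite !big_ord0 subrr normr0 exp2V_gt0.
  have [c' Hc'] := IHn j.+1.
  (* Adding 1 keeps the denominator positive even if [e n] is zero. *)
  have [i Hi] : exists i, 2 ^- i < 2 ^- j.+1 / (`|e n| + 1) :> K.
    by apply: exp2V_archimedean; rewrite divr_gt0 ?exp2V_gt0 // ltr_wpDl.
  have [m Hm] := nat_scalar_dense (c n) i.
  exists (fun k => if k == n then m else c' k).
  rewrite !big_ord_recr /= eqxx opprD addrACA -scalerBl.
  rewrite (eq_bigr (fun i : 'I_n => nat_scalar R F (c' i) *: e i)); last first.
    by move=> k' _; rewrite ltn_eqF.
  rewrite -exp2V_half; apply: le_lt_trans (ler_normD _ _) _.
  apply: ltrD => //; rewrite normrZ distrC.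
  apply: (@le_lt_trans _ _ (`|c n - nat_scalar R F m| * (`|e n| + 1))).
    by rewrite ler_wpM2l // lerDl.
  by rewrite -ltr_pdivlMr ?ltr_wpDl // (lt_trans Hm).
have [||y [yx [n [c [_ yE]]]]] := de ((ball x (2 ^- k.+1 : K))^°)%classic.
- by exists x; apply: nbhs_singleton; apply: nbhs_interior;
    apply: nbhsx_ballx; apply: exp2V_gt0.
- exact: open_interior.
have [c' Hc'] := approx n c k.+1; exists n, c'.
rewrite -exp2V_half -(subrKA y) yE.
apply: le_lt_trans (ler_normD _ _) (ltrD Hc' _); rewrite -yE.
by have := interior_subset yx; rewrite -ball_normE /= distrC.
Qed.

(** * Approximation by an enumeration of the rational span *)

Section Enumeration.
Variables (e a : nat -> X).
Hypotheses (he : effectively_generating S e).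
Hypothesis ha : rational_span_enumeration S e a.

Lemma enumeration_dense x k : exists m, `|a m - x| < 2 ^- k.
Proof.
have [n [c Hc]] := rational_combination_dense he x k.
have [m _ mE] : range a (\sum_(i < n) nat_scalar R F (c i) *: e i).
  rewrite ha.2; exists n, (fun i => nat_scalar R F (c i)); split=> // i.
  exact: rational_nat_scalar.
by exists m; rewrite mE.
Qed.

(** Density makes a search over the indices of [a] succeed, and the search is uniform in [n] and
    [k]. *)
Lemma enumeration_approx u : S u ->
  exists2 p, recursive (uncurry_seq p) &
    forall n k, `|a (p n k) - u n| < 2 ^- k.
Proof.
move=> Su; apply: (@computable_search (fun n m => a m - u n)).
  apply: (computable_sub_seq (u := fun z => a (nsnd z)) (v := fun z => u (nfst z))).
    exact: computable_reindex ha.1 recursive_nsnd.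
  exact: computable_reindex Su recursive_nfst.
by move=> n k; apply: enumeration_dense.
Qed.

Lemma alphaI i x f : (forall n, phi i n (f n)) ->
  (forall n, `|a (f n) - x| < 2 ^- n) -> alpha a i x.
Proof. by move=> Hi Hx; exists f; split=> //; apply: cvg_exp2V. Qed.

Lemma alpha_computable i x : alpha a i x -> computable_elements S x.
Proof.
move=> [f [Hi _ fx]]; have Hf : recursive f.
  apply: (@partial_recursive_total (phi i) f id) => //; first by exists i.
  exact: recursive_id.
by apply: (computable_limit (computable_reindex ha.1 Hf)) => n; apply: ltW.
Qed.

End Enumeration.

End ComputabilityStructure.

(** * Linear operators *)

(* m codes the infinite list of its components, as in an iterated pairing. *)
Definition ncomponent m k := nfst (iter k nsnd m).

Lemma recursive_ncomponent f g : recursive f -> recursive g ->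
  recursive (fun z => ncomponent (f z) (g z)).
Proof.
move=> Hf Hg.
have H : recursive (uncurry_seq (fun m k => iter k nsnd m)).
  apply: (@recursive_primrec id (fun _ _ y => nsnd y)) => //.
    exact: recursive_id.
  exact: recursive_comp recursive_nsnd recursive_nsnd2.
apply: (recursive_comp recursive_nfst).
exact: (recursive_op2 H Hf Hg).
Qed.

Lemma ncomponent_surj n (c : nat -> nat) :
  exists m, forall k, (k < n)%N -> ncomponent m k = c k.
Proof.
elim: n c => [|n IHn] c; first by exists 0%N.
have [m Hm] := IHn (fun k => c k.+1).
exists (npair (c 0%N) m) => -[_|k kn]; rewrite /ncomponent /= ?npairK //.
by rewrite -iterS iterSr npairK; apply: Hm.
Qed.

Section LinearOperator.
Variables (R : realType) (F : scalar_kind).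
Notation K := (scalar_field R F).
Variable X : completeNormedModType (scalar_field R F).
Variables (S : set (nat -> X)) (hS : computability_structure S).
Variables (e a : nat -> X).
Hypotheses (he : effectively_generating S e).
Hypothesis ha : rational_span_enumeration S e a.
Variables (T : X -> X) (hT : linear_operator S T).
Implicit Types (x y l : X) (u v : nat -> X).
Notation Xk := (computable_elements S).

Lemma operatorB x y : Xk x -> Xk y -> T (x - y) = T x - T y.
Proof.
move=> Hx Hy; have := hT.2 (-1) y x (@computable_scalar_int R F (-1)) Hy Hx.
by rewrite !scaleN1r addrC => ->; rewrite addrC.
Qed.

Lemma computable_a n : Xk (a n).
Proof. exact: (computable_term hS n ha.1). Qed.

Lemma computable0 : Xk 0.
Proof. by rewrite -(subrr (a 0%N)); apply: (computable_sub hS); apply: computable_a. Qed.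

Lemma operator0 : T 0 = 0.
Proof.
by rewrite -{1}(subrr (0 : X)) operatorB ?subrr //; apply: computable0.
Qed.

(** Numbers the rational combinations of [u] by codes independent of [u], so that [T] acts by
    replacing [u] with [T \o u]. The number of terms has the form required by [linear_forms]. *)
Definition combination u m : X :=
  \sum_(k < (nfst m).+1) nat_scalar R F (ncomponent (nsnd m) k) *: u k.

Lemma computable_combination u : S u -> S (combination u).
Proof.
move=> Su; have -> : combination u = (fun m => \sum_(k < (nfst m).+1)
    (nat_scalar R F (ncomponent (nsnd m) k) *: u k + 0 *: u k)).
  by apply: funext => m; apply: eq_bigr => k _; rewrite scale0r addr0.
apply: (linear_forms hS (c := fun _ _ => 0)
  (b := fun m k => nat_scalar R F (ncomponent (nsnd m) k))) => //.
- apply: (@computable_nat_scalar R F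
    (fun z => ncomponent (nsnd (nfst z)) (nsnd z))).
  by apply: recursive_ncomponent; solve_recursive.
- exact: (computable_scalar_int R F 0).
- exact: recursive_nfst.
Qed.

Lemma operator_combination u m : S u ->
  T (combination u m) = combination (T \o u) m.
Proof.
move=> Su; rewrite /combination; move: (nfst m).+1 => n.
(* Membership in [Xk] is carried through the induction because linearity is available only on
   computable elements. *)
suff [] : Xk (\sum_(k < n) nat_scalar R F (ncomponent (nsnd m) k) *: u k) /\
  T (\sum_(k < n) nat_scalar R F (ncomponent (nsnd m) k) *: u k) =
  \sum_(k < n) nat_scalar R F (ncomponent (nsnd m) k) *: (T \o u) k by [].
elim: n => [|n [IH1 IH2]].
  by rewrite !big_ord0; split; [apply: computable0 | apply: operator0].
have Hc : computable_scalar (nat_scalar R F (ncomponent (nsnd m) n)).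
  exact: (@computable_nat_scalar R F (fun _ => _) (recursive_const _)).
have Hu := computable_term hS n Su.
rewrite !big_ord_recr /= addrC; split; first exact: computable_lin.
by rewrite hT.2 // IH2 addrC.
Qed.

Lemma combination_dense u : effectively_generating S u ->
  forall x k, exists m, `|combination u m - x| < 2 ^- k.
Proof.
move=> Hu x k; have [n [c Hc]] := rational_combination_dense Hu x k.
(* A code with first component [n] has [n.+1] terms; the last one is given coefficient zero. *)
have [z0 Hz0] := nat_scalar_int R F 0.
have [m Hm] := ncomponent_surj n.+1 (fun i => if (i < n)%N then c i else z0).
exists (npair n m); rewrite /combination !npairK big_ord_recr /=.
rewrite Hm // ltnn Hz0 scale0r addr0.
rewrite (eq_bigr (fun i : 'I_n => nat_scalar R F (c i) *: u i)) //.
by move=> i _; rewrite Hm ?ltn_ord // ltnW // ltnS ltn_ord.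
Qed.

(** A Lipschitz constant that is a power of two is absorbed by shifting the precision by [c]. *)
Lemma bounded_operator_exp2 : bounded_operator S T ->
  exists c, forall x y, Xk x -> Xk y -> `|T x - T y| <= 2 ^+ c * `|x - y|.
Proof.
move=> [M HM].
have [c Hc] : exists c, 2 ^- c < (`|M| + 1)^-1 :> K.
  by apply: exp2V_archimedean; rewrite invr_gt0 ltr_wpDl.
exists c => x y Hx Hy; rewrite -operatorB //.
have := HM _ (computable_sub hS Hx Hy) => {}HM.
(* The bound [M] is an arbitrary scalar, so it is first replaced by its absolute value. *)
rewrite -(normr_id (T _)); apply: le_trans (_ : `|M| * `|x - y| <= _).
  rewrite -[X in _ * X]normr_id -normrM.
  by rewrite ger0_le_norm // ?nnegrE // (le_trans _ HM).
apply: ler_wpM2r => //; move: Hc; rewrite ltf_pV2 ?posrE ?exprn_gt0 ?ltr_wpDl //.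
by move=> /ltW; apply: le_trans; rewrite lerDl.
Qed.

(** The rational combinations [v] of the sequence on which [T] is known have computable images, and
    they approximate each [a n] effectively; the Lipschitz bound carries the approximation over to
    [T (a n)]. *)
Lemma determined_computable_image : effectively_determined S T -> S (T \o a).
Proof.
move=> [/bounded_operator_exp2[c Tc] [u Hu STu]].
have Sv := computable_combination Hu.1; set v := combination u in Sv *.
have STv : S (T \o v).
  have -> : T \o v = combination (T \o u).
    by apply: funext => m; apply: operator_combination Hu.1.
  exact: computable_combination.
have Ev := combination_dense Hu.
have [|n k|p Hp pP] := computable_search hS (u := fun n m => v m - a n).
- apply: (computable_sub_seq hS (u := fun z => v (nsnd z)) (v := fun z => a (nfst z))).
    exact: (computable_reindex hS Sv recursive_nsnd).
  exact: (computable_reindex hS ha.1 recursive_nfst).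
- exact: Ev.
(* The modulus [N + c] compensates for the factor [2 ^+ c]. *)
apply: (effective_limits hS (x := fun n k => T (v (p n k)))
  (m := fun _ N => (N + c)%N)).
- exact: (computable_reindex hS STv Hp).
- by rewrite /uncurry_seq; solve_recursive.
- move=> n N k Nk.
  apply: le_trans (Tc _ _ _ _) _; [exact: computable_term|exact: computable_a|].
  rewrite -ler_pdivlMl ?exprn_gt0 // -invfM -exprD addnC.
  exact: ltW (lt_le_trans (pP n k) (exp2V_le _ Nk)).
Qed.

Lemma determined_effective : effectively_determined S T -> effective a T.
Proof.
move=> dT; have STa := determined_computable_image dT.
have [c Tc] := bounded_operator_exp2 dT.1.
have [q /recursiveP[Q HQ] qP] := enumeration_approx hS he ha STa.
have /recursiveP[A HA] : recursive (fun n => n + c.+1)%N by solve_recursive.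
(* If [i] is an index of [f], then [g i] is one of the function sending [n] to
   [q (f (n + c.+1)) n.+1]. The Goedel number is spelled out because [i] is a number, not a code. *)
pose g i := npair 5 (npair (goedel Q) (npair 4 (npair
  (npair 5 (npair i (goedel A))) (goedel Succ)))).
have Hg : recursive g by rewrite /g; solve_recursive.
exists (fun i j => g i = j); first exact: Hg.
move=> i x ix; exists (g i) => //.
have Hx := alpha_computable hS ha ix.
have [f [Hi _ fx]] := ix.
apply: (@alphaI _ _ _ _ _ _ (fun n => q (f (n + c.+1)%N) n.+1)) => n.
  have [d Ed _] := Hi 0%N.
  exists (Comp Q (Pair (Comp d A) Succ)); first by rewrite /= Ed.
  have [d' Ed' Hd'] := Hi (n + c.+1)%N.
  rewrite -Ed in Ed'; rewrite (goedel_inj Ed') in Hd'.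
  apply: (@eval_comp _ _ _ (npair (f (n + c.+1)%N) n.+1)).
    apply: eval_pair (eval_succ _).
    exact: eval_comp (HA n) Hd'.
  by have := HQ (npair (f (n + c.+1)%N) n.+1); rewrite uncurry_npair.
(* Half of the error comes from [q], half from [f]: [2 ^+ c] times [2 ^- (n + c.+1)] is
   [2 ^- n.+1]. *)
rewrite -exp2V_half -(subrKA (T (a (f (n + c.+1)%N)))).
apply: le_lt_trans (ler_normD _ _) _; apply: ltr_leD; first exact: qP.
apply: le_trans (Tc _ _ _ _) _ => //; first exact: computable_a.
rewrite -ler_pdivlMl ?exprn_gt0 // -invfM -exprD addnC addSnnS.
exact: ltW.
Qed.

(** * From effectiveness to boundedness *)

Section Effective.
Variable psi : nat -> nat -> Prop.
Hypothesis psi_rec : partial_recursive psi.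
Hypothesis psiP : forall i x, alpha a i x -> exists2 j, psi i j & alpha a j (T x).

(** The s-m-n theorem turns [w] into indices of the [v i], [psi] turns these into indices of the
    [T (v i)], and the universal function evaluates the latter uniformly, with an effective rate of
    convergence. *)
Lemma effective_computable_seq (w : nat -> nat -> nat) v :
  recursive (uncurry_seq w) -> (forall i n, `|a (w i n) - v i| < 2 ^- n) ->
  S (fun i => T (v i)).
Proof.
move=> Hw wv; have [s Hs sP] := recursive_smn Hw.
have H i : exists j, psi (s i) j /\ alpha a j (T (v i)).
  by have [j ? ?] := psiP (alphaI (sP i) (wv i)); exists j.
have [j Hj] := choice H; have jrec : recursive j.
  by apply: (partial_recursive_total psi_rec Hs) => i; case: (Hj i).
have H' i : exists f, (forall n, phi (j i) n (f n)) /\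
    forall n, `|a (f n) - T (v i)| < 2 ^- n.
  by have [_ [f [? _ ?]]] := Hj i; exists f.
have [f Hf] := choice H'.
have frec : recursive (uncurry_seq f).
  by apply: (recursive_universal jrec) => n k; apply: (Hf n).1.
apply: (effective_limits hS (x := fun i n => a (f i n)) (m := fun _ N => N)).
- exact: (computable_reindex hS ha.1 frec).
- exact: recursive_nsnd.
- move=> i N k Nk; apply: ltW.
  exact: lt_le_trans ((Hf i).2 k) (exp2V_le _ Nk).
Qed.

Lemma effective_image u : S u -> S (fun n => T (u n)).
Proof.
move=> /(enumeration_approx hS he ha)[p Hp pP].
exact: effective_computable_seq Hp pP.
Qed.

(* Otherwise the elements equal to l, or to u t if i enters the undecidable set
   at stage t, would be uniformly computable, and their images would decide
   that set. *)
Lemma effective_seq_continuous u l : S u -> (forall n, `|u n - l| <= 2 ^- n) ->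
  forall c, exists n, `|T (u n) - T l| < 2 ^- c.
Proof.
move=> Su ul c; apply: contrapT => /forallNP far.
have {}far n : 2 ^- c <= `|T (u n) - T l|.
  by have /negP := far n; rewrite real_leNgt ?normr_real.
have Hl := computable_limit hS Su ul.
have [p Hp pP] := enumeration_approx hS he ha Su.
have [h [Hh hP]] := undecidable_enumerable.
(* The search will give, for the pair of [i] and [N], the smaller of [N] and the first stage at
   which [i] enters the set. *)
pose t z m := h (nfst z) m || (nsnd z <= m)%N.
have Ht : recursive (uncurry_seq (fun z m => t z m : nat)).
  rewrite /uncurry_seq /t; solve_recursive.
  by apply: (recursive_op2 Hh); solve_recursive.
have [z|tau Htau tauP] := recursive_search Ht.
  by exists (nsnd z); rewrite /t leqnn orbT.
(* The case distinction is classical; computability of the family comes from the approximations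
   [u (tau (npair i n.+2))]. *)
pose v i := if pselect (exists s, h i s) is left ex then u (ex_minn ex) else l.
have vP i n : `|u (tau (npair i n.+2)) - v i| <= 2 ^- n.+1.
  have := tauP (npair i n.+2); rewrite /t !npairK => -[+ tmin].
  have := tmin n.+2; rewrite leqnn orbT => /(_ isT) le_n.
  rewrite /v; case: pselect => [ex|nex].
    case: ex_minnP => s hs smin /orP[/smin le_s|ge_n].
      have := tmin s; rewrite hs => /(_ isT) ge_s.
      have -> : tau (npair i n.+2) = s by apply/eqP; rewrite eqn_leq ge_s.
      by rewrite subrr normr0 ltW // exp2V_gt0.
    (* Here [i] enters only at a stage [s] not before [n.+2], so [u n.+2] and [u s] both lie within
       [2 ^- n.+2] of [l]. *)
    have -> : tau (npair i n.+2) = n.+2 by apply/eqP; rewrite eqn_leq le_n.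
    have := tmin s; rewrite hs => /(_ isT) /(leq_trans ge_n) ns.
    rewrite -exp2V_half -(subrKA l); apply: le_trans (ler_normD _ _) _.
    apply: lerD => //; rewrite distrC.
    exact: le_trans (ul s) (exp2V_le _ ns).
  move=> /orP[hs|ge_n]; first by case: nex; eexists; apply: hs.
  have -> : tau (npair i n.+2) = n.+2 by apply/eqP; rewrite eqn_leq le_n.
  by apply: le_trans (ul _) (exp2V_le _ _).
have STv : S (fun i => T (v i)).
  apply: (@effective_computable_seq (fun i n => p (tau (npair i n.+2)) n.+1)).
    by rewrite /uncurry_seq; solve_recursive.
  move=> i n; rewrite -exp2V_half -(subrKA (u (tau (npair i n.+2)))).
  by apply: le_lt_trans (ler_normD _ _) _; apply: ltr_leD.
have [b Hb bP] := computable_norm_compare hS (computable_sub_seq hS STv (hT.1 _ Hl)).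
(* The distance from [T (v i)] to [T l] is at least [2 ^- c] if [i] is in the set and zero
   otherwise, so the test at precision [c] decides membership. *)
apply: (hP (fun i => b i c)).
  exact: (recursive_op2 Hb recursive_id (recursive_const c)).
move=> i; have := bP i c; rewrite /v; case: pselect => [ex|nex] /=.
  case: (b i c) => // lt_c; split=> // _.
  by have := le_lt_trans (far _) lt_c; rewrite ltxx.
rewrite subrr normr0; case: (b i c) => // /(lt_trans (exp2V_gt0 _ _)).
by rewrite ltxx.
Qed.

Lemma effective_bounded_near0 :
  exists c, forall x, Xk x -> `|x| < 2 ^- c -> `|T x| < 2.
Proof.
have [c Hc] : exists c, forall n, `|a n| < 2 ^- c -> `|T (a n)| < 1.
  apply: contrapT => /forallNP far.
  have {}far k : exists n, `|a n| < 2 ^- k /\ ~~ (`|T (a n)| < 1).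
    have /existsNP[n /not_implyP[an /negP Tan]] := far k; by exists n.
  have [b1 Hb1 b1P] := computable_norm_compare hS ha.1.
  have [b2 Hb2 b2P] := computable_norm_compare hS (effective_image ha.1).
  (* The search accepts only [n] with [a n] of norm below [2 ^- k] and [T (a n)] of norm above one
     half; an [n] supplied by [far k.+1] passes both tests. *)
  have Ht : recursive (uncurry_seq (fun k n => ~~ b1 n k && b2 n 0 : nat)).
    rewrite /uncurry_seq; solve_recursive.
      by apply: (recursive_op2 Hb1); solve_recursive.
    by apply: (recursive_op2 Hb2); solve_recursive.
  have [k|g Hg gP] := recursive_search Ht.
    have [n [an Tan]] := far k.+1; exists n; apply/andP; split.
      apply/negP => bT; have := b1P n k; rewrite bT => /(lt_trans an).
      by rewrite ltxx.
    by have := b2P n 0; case: (b2 n 0) => //; rewrite expr0 invr1 (negPf Tan).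
  have [k|n] := effective_seq_continuous (computable_reindex hS ha.1 Hg) (l := 0) _ 1.
    rewrite subr0 ltW //; have [/andP[/negPf gk _] _] := gP k.
    by have := b1P (g k) k; rewrite gk.
  rewrite operator0 subr0; have [/andP[_ bn] _] := gP n.
  by have := b2P (g n) 0; rewrite bn => /lt_trans/[apply]; rewrite ltxx.
exists c.+1 => x Hx x_lt.
have [p Hp pP] := enumeration_approx hS he ha Hx.
(* The shift by [c.+1] keeps every approximation within [2 ^- c.+1] of [x], hence of norm below
   [2 ^- c], where the bound on [T (a n)] applies. *)
have Hr : recursive (fun n => p 0 (n + c.+1)%N) by solve_recursive.
have [n|n Hn] := effective_seq_continuous (computable_reindex hS ha.1 Hr) (l := x) _ 0.
  exact: ltW (lt_le_trans (pP _ _) (exp2V_le _ (leq_addr _ _))).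
move: Hn; rewrite expr0 invr1 => Hn.
rewrite -(subrK (T (a (p 0 (n + c.+1)%N))) (T x)).
apply: le_lt_trans (ler_normD _ _) _; rewrite [2]mulr2n; apply: ltrD.
  by rewrite distrC.
apply: Hc; rewrite -exp2V_half -(subrK x (a _)).
apply: le_lt_trans (ler_normD _ _) (ltrD _ x_lt).
exact: lt_le_trans (pP _ _) (exp2V_le _ (leq_addl _ _)).
Qed.

(** The usual rescaling of [x] into the ball where [T] is bounded, but by a rational [lam] close to
    [th / |x|], since linearity holds for computable scalars. The error [2 ^- c.+3] is half of
    [th]. *)
Lemma effective_bounded : bounded_operator S T.
Proof.
have [c Hc] := effective_bounded_near0.
pose th : K := 2 ^- c.+2; have th0 : 0 < th by apply: exp2V_gt0.
exists (2 / 2 ^- c.+3) => x Hx; have [->|x0] := eqVneq x 0.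
  by rewrite operator0 !normr0 mulr0.
have nx : 0 < `|x| by rewrite normr_gt0.
have [j Hj] : exists j, 2 ^- j < 2 ^- c.+3 / `|x|.
  by apply: exp2V_archimedean; rewrite divr_gt0 // exp2V_gt0.
have [m Hm] := nat_scalar_dense (th / `|x|) j.
set lam := nat_scalar R F m in Hm *.
have Hlam : computable_scalar lam.
  exact: (@computable_nat_scalar R F (fun _ => m) (recursive_const _)).
have close : `|th - `|lam| * `|x| | < 2 ^- c.+3.
  have -> : th - `|lam| * `|x| = (th / `|x| - `|lam|) * `|x|.
    by rewrite mulrBl divfK // gt_eqF.
  rewrite normrM normr_id -ltr_pdivlMr //; apply: le_lt_trans (lt_trans Hm Hj).
  rewrite -{1}(ger0_norm (ltW (divr_gt0 th0 nx))).
  exact: ler_dist_dist.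
have upper : `|lam *: x| < 2 ^- c.
  rewrite normrZ -(ger0_norm (mulr_ge0 (normr_ge0 lam) (normr_ge0 x))).
  rewrite -{1}(subKr th (`|lam| * `|x|)).
  apply: le_lt_trans (ler_normB _ _) _.
  apply: (@lt_le_trans _ _ (2 ^- c.+1)); last exact: exp2V_le.
  rewrite -exp2V_half (gtr0_norm th0) ltrD2l.
  by apply: lt_le_trans close (exp2V_le _ _).
(* Subtracting the error from [th] leaves [2 ^- c.+3], which bounds [lam] away from zero and gives
   the denominator of the final constant. *)
have lower : 2 ^- c.+3 < `|lam| * `|x|.
  rewrite -(ltrD2r (2 ^- c.+3)) exp2V_half -/th -{1}(gtr0_norm th0).
  rewrite -{1}(subrK (`|lam| * `|x|) th) addrC.
  apply: le_lt_trans (ler_normD _ _) _.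
  by rewrite ger0_norm ?mulr_ge0 // ltrD2l.
have Tlam : `|lam| * `|T x| < 2.
  have := Hc (lam *: x) _ upper; have := hT.2 lam x 0 Hlam Hx computable0.
  rewrite operator0 !addr0 -normrZ => <-; apply.
  by have := computable_lin hS Hlam Hx computable0; rewrite addr0.
rewrite -(ler_pM2l (exp2V_gt0 K c.+3)) mulrA mulrCA divff ?gt_eqF ?exp2V_gt0 //.
rewrite mulr1; apply: le_trans (ler_wpM2r (normr_ge0 _) (ltW lower)) _.
by rewrite mulrAC ler_wpM2r // ltW.
Qed.
End Effective.

Lemma effective_determined : effective a T -> effectively_determined S T.
Proof.
move=> [psi Hpsi psiP]; split; first exact: effective_bounded Hpsi psiP.
(* The sequence [a] itself is the generating sequence: its range is already dense. *)
exists a; last exact: (effective_image Hpsi psiP ha.1).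
split; first exact: ha.1.
move=> O [x Ox] oO.
have /nbhs_ballP[eps /= eps0 xO] : nbhs x O by apply: open_nbhs_nbhs.
have [k Hk] := exp2V_archimedean eps0.
have [m Hm] := enumeration_dense he ha x k.
exists (a m); split.
  by apply: xO; rewrite -ball_normE /= distrC (lt_trans Hm).
(* Kronecker coefficients exhibit [a m] as an element of the linear span of [a]. *)
exists m.+1, (fun i => (i == m)%:R); split=> //.
rewrite big_ord_recr big1 /= => [|i _]; first by rewrite eqxx scale1r add0r.
by rewrite ltn_eqF // scale0r.
Qed.

Lemma bounded_continuous : bounded_operator S T ->
  {within Xk, continuous T}.
Proof.
move=> /bounded_operator_exp2[c Tc]; apply/subspace_continuousP => x Hx.
apply/cvgrPdist_lt => eps eps0.
have d0 : 0 < eps / 2 ^+ c by rewrite divr_gt0 // exprn_gt0.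
rewrite near_withinE; near=> y => Hy.
apply: le_lt_trans (Tc _ _ Hx Hy) _.
rewrite mulrC -ltr_pdivlMr ?exprn_gt0 //.
Unshelve. all: by end_near.
Qed.

End LinearOperator.

Theorem theorem42 (R : realType) (F : scalar_kind)
    (X : completeNormedModType (scalar_field R F))
    (S : set (nat -> X)) (hS : computability_structure S)
    (e : nat -> X) (he : effectively_generating S e)
    (a : nat -> X) (ha : rational_span_enumeration S e a)
    (T : X -> X) (hT : linear_operator S T) :
  effective a T <->
  effectively_determined S T /\ {within computable_elements S, continuous T}.
Proof.
split=> [eT|[dT _]]; last exact: (determined_effective hS he ha hT dT).
have dT := effective_determined hS he ha hT eT; split=> //.
exact: (bounded_continuous hS hT dT.1).
Qed.
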